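(* Let $n\in\mathbb N$, $n\ge1$, and let $\mathbb C_n=\mathbb Q\times n$ with $\langle q_1,i_1\rangle<\langle q_2,i_2\rangle$ iff $q_1<_{\mathbb Q}q_2$. For each $\mathbb R$-embeddable complete linear order $L$ whose least element $0_L$ is non-isolated, there is a maximal chain in $\langle\mathbb P(\mathbb C_n)\cup\{\emptyset\},\subset\rangle$ isomorphic to $L$.
   Context: $\mathbb P(\mathbb X)$ is the set of subsets of the domain of $\mathbb X$ whose induced suborder is isomorphic to $\mathbb X$. A linear order is complete if it has a least element $0_L$, a greatest element and no gaps; $0_L$ is non-isolated if it has no immediate successor; $\mathbb R$-embeddable means embeddable into $\langle\mathbb R,<\rangle$.
   Formalization: The formal theorem additionally assumes that L has at least two elements: the one-point order has a least element with no immediate successor, but every maximal chain contains both ∅ and C_n, so the claim fails for it. *)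

(* Defs.v *)
From mathcomp Require Import all_boot all_order all_algebra.
From mathcomp Require Import all_classical all_reals.
Set Implicit Arguments.
Unset Strict Implicit.
Unset Printing Implicit Defensive.
Import Order.TTheory GRing.Theory Num.Theory.
Local Open Scope classical_set_scope.

(* The structure (T, rT) is isomorphic to the substructure of (U, rU) induced
   on A. *)
Definition iso_onto (T U : Type) (rT : T -> T -> Prop) (rU : U -> U -> Prop)
    (A : set U) : Prop :=
  exists f : T -> U,
    set_bij [set: T] A f /\ (forall x y, rT x y <-> rU (f x) (f y)).

Definition copies (T : Type) (r : T -> T -> Prop) : set (set T) :=
  [set A | iso_onto r r A].

Definition Cn_lt (n : nat) (x y : rat * 'I_n) : Prop := (x.1 < y.1)%R.

Definition is_chain (T : Type) (F C : set (set T)) : Prop :=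
  C `<=` F /\ total_on C subset.

Definition is_maximal_chain (T : Type) (F C : set (set T)) : Prop :=
  is_chain F C /\ (forall D, is_chain F D -> C `<=` D -> D = C).

Section LinearOrders.
Context {d : Order.disp_t} {L : orderType d}.
Local Open Scope order_scope.

Definition is_least (x : L) : Prop := forall y : L, x <= y.

Definition is_greatest (x : L) : Prop := forall y : L, y <= x.

Definition is_cut (A B : set L) : Prop :=
  [/\ A `|` B = [set: L], A !=set0, B !=set0
    & forall a b, A a -> B b -> a < b].

Definition is_gap (A B : set L) : Prop :=
  [/\ is_cut A B, ~ (exists2 m, A m & ubound A m)
    & ~ (exists2 m, B m & lbound B m)].

Definition immediate_successor (x y : L) : Prop :=
  x < y /\ ~ (exists z : L, x < z < y).

(* On a one-point order this holds vacuously. *)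
Definition non_isolated (x : L) : Prop :=
  ~ (exists y : L, immediate_successor x y).

End LinearOrders.

Definition complete_order (d : Order.disp_t) (L : orderType d) : Prop :=
  [/\ exists x : L, is_least x, exists x : L, is_greatest x
    & forall A B : set L, ~ is_gap A B].

Definition order_embeddable (d d' : Order.disp_t) (L : orderType d)
    (M : orderType d') : Prop :=
  exists f : L -> M, forall x y : L, (x < y)%O <-> (f x < f y)%O.

(* Main.v *)
(* A copy of [C_n] is a set [S * n] with [S] a dense suborder of [Q] without end
   points, or equivalently, by Cantor's theorem, a copy of [Q]; so it suffices to
   treat [Q]. Let [J] be the set of points of [L] with an immediate predecessor
   and [K] a countable dense set of points interior to the jump-free intervals.
   Rearrange the countable set [J u K] into a copy of [Q] by giving its elements
   new positions [p] in [R], and attach to [x] in [L] the set of the elements of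
   [J] that are [<= x] and of [K] that are [< x]. Two demands on [p] make these
   sets a maximal chain of copies of [Q]: each of them is dense without end
   points, and [k] in [K] comes after all elements of the set attached to [k], so
   that adding [k] alone creates a greatest element. If [J] is coinitial in
   [L \ {0}], the set [J] is shuffled densely below [K]; otherwise an initial
   interval of [L] is jump-free and [J] is inserted into it. *)
Require Import Defs.
From mathcomp Require Import all_boot all_order all_algebra.
From mathcomp Require Import all_classical all_reals.
Set Implicit Arguments.
Unset Strict Implicit.
Unset Printing Implicit Defensive.
Import Order.TTheory GRing.Theory Num.Theory.
Local Open Scope classical_set_scope.

(** * Cantor's theorem on countable dense orders, by back-and-forth *)

Section Cantor.
Local Open Scope order_scope.

(** Stated for a subset of an ambient order, so that no subtype is formed. The empty set satisfies
    it, which lets it cover the member [set0] of the chain too. *)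
Definition dense_endless (d : Order.disp_t) (T : orderType d) (A : set T) :=
  [/\ forall x, A x -> exists2 y, A y & y < x,
      forall x, A x -> exists2 y, A y & x < y
    & forall x y, A x -> A y -> x < y -> exists2 z, A z & x < z < y].

Lemma seq_max_in (d : Order.disp_t) (T : orderType d) (x0 : T) (s : seq T) :
  exists2 m, m \in x0 :: s & forall y, y \in x0 :: s -> y <= m.
Proof.
elim: s x0 => [|x s IHs] x0.
  by exists x0; rewrite ?mem_head // => y; rewrite inE => /eqP->.
have [m ms mP] := IHs x; have [le|lt] := leP x0 m.
  exists m; first by rewrite inE ms orbT.
  by move=> y; rewrite inE => /predU1P[->//|/mP].
exists x0; first exact: mem_head.
by move=> y; rewrite inE => /predU1P[->//|/mP /le_trans]; apply; apply: ltW.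
Qed.

Lemma seq_min_in (d : Order.disp_t) (T : orderType d) (x0 : T) (s : seq T) :
  exists2 m, m \in x0 :: s & forall y, y \in x0 :: s -> m <= y.
Proof. exact: (@seq_max_in _ T^d). Qed.

Lemma dense_endless_between (d : Order.disp_t) (T : orderType d) (A : set T)
    (l u : seq T) :
  dense_endless A -> A !=set0 -> {in l, forall x, A x} ->
  {in u, forall x, A x} -> {in l & u, forall x y, x < y} ->
  exists2 z, A z & {in l, forall x, x < z} /\ {in u, forall y, z < y}.
Proof.
move=> [lowA upA midA] [a Aa]; case: l u => [|l0 l] [|u0 u] lA uA lu.
- by exists a.
- have [m mu mP] := seq_min_in u0 u; have [z Az zm] := lowA m (uA m mu).
  by exists z => //; split=> // y /mP; apply: lt_le_trans.
- have [m ml mP] := seq_max_in l0 l; have [z Az zm] := upA m (lA m ml).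
  by exists z => //; split=> // y /mP /le_lt_trans; apply.
- have [m ml mP] := seq_max_in l0 l; have [m' mu mP'] := seq_min_in u0 u.
  have [z Az /andP[mz zm]] := midA m m' (lA m ml) (uA m' mu) (lu m m' ml mu).
  exists z => //; split=> y; first by move=> /mP /le_lt_trans; apply.
  by move=> /mP'; apply: lt_le_trans.
Qed.

Definition partial_iso (d1 d2 : Order.disp_t) (T1 : orderType d1)
    (T2 : orderType d2) (A : set T1) (B : set T2) (s : seq (T1 * T2)) :=
  {in s, forall u, A u.1 /\ B u.2} /\
  {in s &, forall u v, (u.1 < v.1) = (u.2 < v.2)}.

(** The forth step: unless [x] already has a partner, it gets one between the images of the finitely
    many points below it and those of the points above it. *)
Lemma partial_iso_extend (d1 d2 : Order.disp_t) (T1 : orderType d1)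
    (T2 : orderType d2) (A : set T1) (B : set T2) (s : seq (T1 * T2)) (x : T1) :
  dense_endless B -> B !=set0 -> partial_iso A B s -> A x ->
  exists y, partial_iso A B ((x, y) :: s).
Proof.
move=> deB B0 [sAB siso] Ax.
have [[[x' y] us /= xx']|nx] := pselect (exists2 u, u \in s & x = u.1).
  subst x'; exists y; split=> [u|u v]; rewrite !inE.
    by case/predU1P=> [->/=|/sAB//]; have [] := sAB _ us.
  by do 2 case/predU1P=> [->|?]; apply: siso.
pose l := [seq u.2 | u <- s & u.1 < x]; pose r := [seq u.2 | u <- s & x < u.1].
have [y By [ly ry]] : exists2 z, B z &
    {in l, forall y, y < z} /\ {in r, forall y, z < y}.
  apply: dense_endless_between => //.
  - by move=> _ /mapP[u + ->]; rewrite mem_filter => /andP[_ /sAB[]].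
  - by move=> _ /mapP[u + ->]; rewrite mem_filter => /andP[_ /sAB[]].
  - move=> _ _ /mapP[u + ->] /mapP[v + ->]; rewrite !mem_filter.
    by move=> /andP[ux us] /andP[xv vs]; rewrite -siso //; apply: lt_trans xv.
have cmp u : u \in s -> ((u.1 < x) = (u.2 < y)) * ((x < u.1) = (y < u.2)).
  move=> us; case: (ltgtP u.1 x) => [ux|xu|E].
  - have uy : u.2 < y by apply/ly/map_f; rewrite mem_filter ux.
    by rewrite uy (lt_gtF uy).
  - have uy : y < u.2 by apply/ry/map_f; rewrite mem_filter xu.
    by rewrite uy (lt_gtF uy).
  - by case: nx; exists u.
exists y; split=> [u|u v]; rewrite !inE; first by case/predU1P=> [->//|/sAB].
case/predU1P=> [->|us] /predU1P[->|vs] /=; rewrite ?ltxx ?cmp //; exact: siso.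
Qed.

Lemma partial_iso_swap (d1 d2 : Order.disp_t) (T1 : orderType d1)
    (T2 : orderType d2) (A : set T1) (B : set T2) (s : seq (T1 * T2)) :
  partial_iso A B s -> partial_iso B A [seq (u.2, u.1) | u <- s].
Proof.
move=> [sAB siso]; split=> [_ /mapP[u us ->]|_ _ /mapP[u us ->] /mapP[v vs ->]].
  by have [] := sAB u us.
by rewrite /= siso.
Qed.

(** Step [k] of the back-and-forth handles the point of [A] and the point of [B] with code [k], if
    they exist; the union [G] of the finite stages is the graph of the isomorphism. *)
Lemma cantor_iso (d1 d2 : Order.disp_t) (T1 : orderType d1)
    (T2 : orderType d2) (A : set T1) (B : set T2) :
  countable A -> countable B -> A !=set0 -> B !=set0 ->
  dense_endless A -> dense_endless B ->
  exists f : T1 -> T2, set_bij A B f /\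
    forall x y, A x -> A y -> (x < y) = (f x < f y).
Proof.
move=> /countable_injP[cA cAinj] /countable_injP[cB cBinj] A0 B0 deA deB.
(* The hypothesis on [s] stands under the existential, so that choice yields a function [F] on all
   lists. *)
have step (k : nat) (s : seq (T1 * T2)) : exists s', partial_iso A B s ->
    [/\ partial_iso A B s', {subset s <= s'},
        forall x, A x -> cA x = k -> exists y, (x, y) \in s'
      & forall y, B y -> cB y = k -> exists x, (x, y) \in s'].
  have [sP|nsP] := pselect (partial_iso A B s); last by exists s.
  have [s1 [s1P ss1 s1x]] : exists s1, [/\ partial_iso A B s1, {subset s <= s1}
      & forall x, A x -> cA x = k -> exists y, (x, y) \in s1].
    have [[x Ax cx]|nx] := pselect (exists2 x, A x & cA x = k).
      have [y yP] := partial_iso_extend deB B0 sP Ax.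
      exists ((x, y) :: s); split=> // [u us|x' Ax' cx'].
        by rewrite inE us orbT.
      by exists y; rewrite (cAinj x' x) ?mem_head ?inE // cx cx'.
    by exists s; split=> // x Ax cx; case: nx; exists x.
  have [[y By cy]|ny] := pselect (exists2 y, B y & cB y = k).
    have [x xP] := partial_iso_extend deA A0 (partial_iso_swap s1P) By.
    exists ((x, y) :: s1) => _; split.
    - have := partial_iso_swap xP; rewrite /= -map_comp (@eq_map _ _ _ id).
        by rewrite map_id.
      by case.
    - by move=> u /ss1 us; rewrite inE us orbT.
    - move=> x' Ax' /(s1x x' Ax')[y' ?].
      by exists y'; rewrite inE; apply/orP; right.
    - move=> y' By' cy'.
      by exists x; rewrite (cBinj y' y) ?mem_head ?inE // cy cy'.
  by exists s1 => _; split=> // y By cy; case: ny; exists y.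
have /choice[F FP] : forall ks : nat * seq (T1 * T2), exists s',
    partial_iso A B ks.2 ->
    [/\ partial_iso A B s', {subset ks.2 <= s'},
        forall x, A x -> cA x = ks.1 -> exists y, (x, y) \in s'
      & forall y, B y -> cB y = ks.1 -> exists x, (x, y) \in s'].
  by move=> [k s]; apply: step.
pose S := fix S k := if k is k'.+1 then F (k', S k') else [::].
have SP k : partial_iso A B (S k).
  by elim: k => [|k IHk] /=; [split | have [] := FP (k, S k) IHk].
have Smono j k : (j <= k)%N -> {subset S j <= S k}.
  elim: k => [|k IHk]; first by rewrite leqn0 => /eqP->.
  rewrite leq_eqVlt => /predU1P[->//|/IHk jk u /jk uk].
  by have [_ /(_ u uk)] := FP (k, S k) (SP k).
pose G x y := exists k, (x, y) \in S k.
have Giso x y x' y' : G x y -> G x' y' -> (x < x') = (y < y').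
  move=> [k xy] [j xy']; have [_ iso] := SP (maxn k j).
  by apply: (iso (x, y) (x', y')); [apply: Smono xy | apply: Smono xy'];
     rewrite ?leq_maxl ?leq_maxr.
have Gmem x y : G x y -> A x /\ B y.
  by move=> [k xy]; have [/(_ _ xy)] := SP k.
have GA x : A x -> exists y, G x y.
  move=> Ax; have [_ _ /(_ x Ax erefl)[y xy] _] := FP (cA x, S (cA x)) (SP _).
  by exists y, (cA x).+1.
have GB y : B y -> exists x, G x y.
  move=> By; have [_ _ _ /(_ y By erefl)[x xy]] := FP (cB y, S (cB y)) (SP _).
  by exists x, (cB y).+1.
have [b0 _] := B0; pose f x := xget b0 (G x).
have fP x : A x -> G x (f x) by move=> /GA[y]; apply: xgetI.
exists f; split; last by move=> x y Ax Ay; apply: Giso; apply: fP.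
split=> [x /fP /Gmem[]//|x x' /set_mem Ax /set_mem Ax' ff|y By].
  have := Giso _ _ _ _ (fP _ Ax) (fP _ Ax').
  have := Giso _ _ _ _ (fP _ Ax') (fP _ Ax).
  by rewrite ff ltxx; case: ltgtP.
have [x Gxy] := GB y By; have [Ax _] := Gmem _ _ Gxy; exists x => //.
have := Giso _ _ _ _ (fP _ Ax) Gxy; have := Giso _ _ _ _ Gxy (fP _ Ax).
by rewrite ltxx; case: ltgtP.
Qed.

Lemma dense_endless_rat : dense_endless [set: rat].
Proof.
split=> [x _|x _|x y _ _ xy].
- by exists (x - 1)%R => //; rewrite ltrBlDr ltrDl.
- by exists (x + 1)%R => //; rewrite ltrDl.
- by exists ((x + y) / 2)%R => //; rewrite !midf_lt.
Qed.

End Cantor.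

(** * Copies of C_n as cylinders over dense sets of rationals *)

Section Copies.
Variable n : nat.
Hypothesis n_ge1 : (1 <= n)%N.

Definition cylinder (S : set rat) : set (rat * 'I_n) := [set x | S x.1].

Lemma cylinder_sub (S S' : set rat) :
  (cylinder S `<=` cylinder S') <-> (S `<=` S').
Proof.
split=> [sub q Sq|sub x]; last exact: sub.
by have := sub (q, Ordinal n_ge1) Sq.
Qed.

(** Cantor's isomorphism from the rationals to [S] is applied to first coordinates, and second
    coordinates are kept. *)
Lemma dense_endless_copy (S : set rat) : dense_endless S ->
  (copies (@Cn_lt n) `|` [set set0]) (cylinder S).
Proof.
move=> deS; have [S0|/set0P S0] := eqVneq S set0.
  by right; rewrite S0.
have T0 : [set: rat] !=set0 by exists 0%R.
have cT : countable [set: rat] by apply: countableP.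
have cS : countable S by apply: countableP.
have [f [[fS finj fsurj] fmono]] :=
  cantor_iso cT cS T0 S0 dense_endless_rat deS.
left; exists (fun x => (f x.1, x.2)); split; last first.
  by move=> x y; rewrite /Cn_lt /= fmono.
split=> [x _|[q i] [q' i'] _ _ [+ ->]|[q i] Sq].
- exact: fS.
- by move=> /finj->; rewrite ?inE.
- by have [r _ <-] := fsurj q Sq; exists (r, i).
Qed.

(** Points are incomparable exactly when their first coordinates agree, so an isomorphism maps
    fibres into fibres and induces a strictly increasing map [h] on the rationals; [S] is its
    range. *)
Lemma copy_dense_endless (A : set (rat * 'I_n)) :
  (copies (@Cn_lt n) `|` [set set0]) A ->
  exists2 S, dense_endless S & A = cylinder S.
Proof.
case=> [[f [[fA finj fsurj] fiso]]|->]; last first.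
  by exists set0 => //; split=> [? []|? []|? ? []].
have fiso1 x y : (x.1 < y.1)%R = ((f x).1 < (f y).1)%R.
  by apply/idP/idP; case: (fiso x y).
have fiber r i j : (f (r, i)).1 = (f (r, j)).1.
  have := fiso1 (r, i) (r, j); have := fiso1 (r, j) (r, i).
  by rewrite /= ltxx; case: ltgtP.
(* The [n] points of a fibre are pairwise incomparable, so they fill the fibre
   over a single rational. *)
have full r i k : exists j, f (r, j) = ((f (r, i)).1, k).
  pose g j := (f (r, j)).2.
  have ginj : injective g.
    move=> j j' gjj; suff : (r, j) = (r, j') by case.
    apply: finj; rewrite ?inE //.
    rewrite (surjective_pairing (f (r, j))) (surjective_pairing (f (r, j'))).
    by rewrite (fiber r j j') -/(g j) gjj.
  have [g' _ gK'] := injF_bij ginj; exists (g' k).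
  by rewrite (surjective_pairing (f _)) -/(g _) gK' (fiber r (g' k) i).
pose i0 := Ordinal n_ge1; pose h q := (f (q, i0)).1.
have hmono q r : (q < r)%R = (h q < h r)%R by exact: (fiso1 (q, i0) (r, i0)).
exists (range h); last first.
  rewrite predeqE => -[q k]; split=> [/fsurj[[r i] _ fri]|[r _ /= hr]].
    by exists r => //=; rewrite /h (fiber r i0 i) fri.
  by rewrite -hr; have [j <-] := full r i0 k; apply: fA.
have [low up mid] := dense_endless_rat.
split=> [_ [q _ <-]|_ [q _ <-]|_ _ [q _ <-] [r _ <-]].
- by have [r _ rq] := low q I; exists (h r); rewrite -?hmono //; exists r.
- by have [r _ rq] := up q I; exists (h r); rewrite -?hmono //; exists r.
- rewrite -hmono => qr; have [t _ ?] := mid q r I I qr.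
  by exists (h t); rewrite -?hmono //; exists t.
Qed.
End Copies.
Arguments cylinder : clear implicits.

(** * Jumps, stages and suprema in the order L *)

Section Stages.
Context {d : Order.disp_t} {L : orderType d}.
Local Open Scope order_scope.
Implicit Types (x y w e k j : L) (K : set L).

Definition has_pred : set L := [set x | exists w, immediate_successor w x].

(** Open at [x] and closed at [y]: a jump has both ends in [x, y] exactly when its right end lies in
    this range. *)
Definition jump_free x y := ~ exists2 j, has_pred j & x < j <= y.

Definition inner : set L := [set x | exists a b, a < x < b /\ jump_free a b].

(* [K] supplies the points of the chain in the jump-free intervals; a point of
   [K] enters only after its own stage, a right end of a jump at its stage. *)
Definition stage K x : set L :=
  [set e | has_pred e /\ e <= x \/ K e /\ e < x].

Definition support K : set L := [set e | has_pred e \/ K e].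

Lemma not_has_pred x y : x < y -> ~ has_pred y -> exists w, x < w < y.
Proof. by move=> xy npy; apply: contrapT => nw; apply: npy; exists x. Qed.

Lemma jump_free_sub a b x y : jump_free a b -> a <= x -> y <= b -> jump_free x y.
Proof.
move=> free ax yb [j Jj /andP[xj jy]]; apply: free; exists j => //.
by rewrite (le_lt_trans ax xj) (le_trans jy yb).
Qed.

Lemma jump_free_dense x y : x < y -> jump_free x y -> exists w, x < w < y.
Proof.
move=> xy free; apply: not_has_pred => // Jy; apply: free.
by exists y; rewrite ?xy /=.
Qed.

Lemma inner_not_has_pred x : inner x -> ~ has_pred x.
Proof.
move=> [a [b [/andP[ax xb] free]]] Jx; apply: free.
by exists x; rewrite // ax ltW.
Qed.

Lemma stage_le K x y : x <= y -> stage K x `<=` stage K y.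
Proof.
move=> xy e [[Je ex]|[Ke ex]]; first by left; split=> //; apply: le_trans xy.
by right; split=> //; apply: lt_le_trans xy.
Qed.

Lemma stage_strict K x y :
  (forall a b, a < b -> jump_free a b -> exists2 k, K k & a < k < b) ->
  x < y -> exists2 e, stage K y e & ~ stage K x e.
Proof.
move=> Kdense xy.
have [[j Jj /andP[xj jy]]|free] :=
    pselect (exists2 j, has_pred j & x < j <= y).
  exists j; first by left.
  by case=> -[_]; [rewrite leNgt xj | rewrite ltNge (ltW xj)].
have [k Kk /andP[xk ky]] := Kdense x y xy free; exists k; first by right.
by case=> -[_]; [rewrite leNgt xk | rewrite ltNge (ltW xk)].
Qed.

(** The down-closure of [B] and its complement form a cut unless the former has a maximum; as there
    are no gaps, one of the two has an end point at the cut, and this is the supremum. *)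
Lemma complete_sup (B : set L) : complete_order L -> B !=set0 ->
  exists x, (forall b, B b -> b <= x) /\
    forall y, y < x -> exists2 b, B b & y < b.
Proof.
move=> [_ [top topP] nogap] [b0 Bb0].
pose A : set L := [set y | exists2 b, B b & y <= b].
have Ale y : ~ A y -> forall b, B b -> b < y.
  by move=> nAy b Bb; rewrite ltNge; apply/negP => yb; apply: nAy; exists b.
have [[m [b Bb mb] mub]|nmax] := pselect (exists2 m, A m & ubound A m).
  have E : m = b by apply/eqP; rewrite eq_le mb mub //; exists b.
  exists m; split=> [b' Bb'|y ym]; first by apply: mub; exists b'.
  by exists b; rewrite // -E.
have AB : is_cut A (~` A).
  split; first exact: setUv.
  - by exists b0, b0.
  - exists top => -[b Bb tb]; apply: nmax.
    by exists top => [|y _]; [exists b | exact: topP].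
  - move=> a c [b Bb ab] nAc; apply: le_lt_trans ab _; exact: Ale.
have [m nAm mlb] : exists2 m, (~` A) m & lbound (~` A) m.
  by apply: contrapT => nmin; apply: (nogap A (~` A)).
exists m; split=> [b Bb|y ym]; first by apply/ltW/Ale.
have Ay : A y by apply: contrapT => /mlb; rewrite leNgt ym.
apply: contrapT => nb; apply: nmax; exists y => // z [b Bb zb].
by apply: le_trans zb _; rewrite leNgt; apply/negP => yb; apply: nb; exists b.
Qed.

End Stages.

(** * The maximal chain obtained from suitable positions *)

Section Chain.
Context {d : Order.disp_t} {L : orderType d}.
Local Open Scope order_scope.
Variables (R : realType) (n : nat) (K : set L) (p : L -> R).
Hypothesis n_ge1 : (1 <= n)%N.
Hypothesis L_nontrivial : exists x y : L, x < y.
Hypothesis L_complete : complete_order L.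
Hypothesis K_inner : K `<=` inner.
Hypothesis K_dense : forall x y : L, x < y -> jump_free x y ->
  exists2 k, K k & x < k < y.
Hypothesis E_countable : countable (support K).
Hypothesis p_inj : {in support K &, injective p}.
Hypothesis K_top : forall k e, K k -> stage K k e -> p e < p k.
Hypothesis stage_de : forall x, dense_endless (p @` stage K x).

Let E := support K.

Let stageE x e : stage K x e -> E e.
Proof. by case=> -[]; [left | right]. Qed.

(** Replaces the real positions by rational ones: [phi] lists the support along the rationals in the
    order of [p]. *)
Lemma positions : exists phi : rat -> L,
  [/\ forall q, E (phi q), forall e, E e -> exists q, phi q = e
    & forall q r, (q < r) = (p (phi q) < p (phi r))].
Proof.
have [_ [top topP] _] := L_complete.
(* Points of [K] are inner, hence below [top]; so the support is itself a stage and [stage_de]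
   applies to it. *)
have ET : E = stage K top.
  apply/seteqP; split=> [e [Je|Ke]|e /stageE//]; first by left.
  right; split=> //; have [a [b [/andP[_ eb] _]]] := K_inner Ke.
  exact: lt_le_trans eb (topP b).
have cT : countable [set: rat] by apply: countableP.
have cE : countable (p @` E).
  by apply: sub_countable E_countable; apply: card_image_le.
have T0 : [set: rat] !=set0 by exists 0%R.
have E0 : p @` E !=set0.
  have [x [y xy]] := L_nontrivial.
  by have [e /stageE Ee _] := stage_strict K_dense xy; exists (p e), e.
have deE : dense_endless (p @` E) by rewrite ET.
have [f [[fE _ fsurj] fmono]] := cantor_iso cT cE T0 E0 dense_endless_rat deE.
have /choice[phi phiP] q : exists e, E e /\ p e = f q.
  by have [e Ee <-] := fE q I; exists e.
exists phi; split=> [q|e Ee|q r]; first by have [] := phiP q.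
  have [q _ fq] : (f @` [set: rat]) (p e) by apply: fsurj; exists e.
  exists q; have [Ephi pphi] := phiP q.
  by apply: p_inj; rewrite ?inE // pphi.
by have [_ ->] := phiP q; have [_ ->] := phiP r; apply: fmono.
Qed.

Lemma stages_maximal_chain : exists C : set (set (rat * 'I_n)),
  is_maximal_chain (copies (@Cn_lt n) `|` [set set0]) C /\
  iso_onto (fun x y : L => x < y) (fun A B : set (rat * 'I_n) => A `<` B) C.
Proof.
have [phi [phiE phi_surj phi_mono]] := positions.
have phi_inj : injective phi.
  move=> q r qr; have := phi_mono q r; have := phi_mono r q.
  by rewrite qr ltxx; case: ltgtP.
have [[bot botP] [top topP] _] := L_complete.
pose A x := [set q | stage K x (phi q)].
have Ale x y : x <= y -> A x `<=` A y by move=> xy q; apply: stage_le.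
have Alt x y : x < y -> ~ A y `<=` A x.
  move=> /(stage_strict K_dense)[e ye xe] yx.
  have [q qe] := phi_surj e (stageE ye).
  by apply: xe; rewrite -qe; apply: yx; rewrite /A /= qe.
have Ade x : dense_endless (A x).
  have [low up mid] := stage_de x.
  have lift e : stage K x e -> exists2 q, A x q & phi q = e.
    move=> xe; have [q qe] := phi_surj e (stageE xe).
    by exists q; rewrite // /A /= qe.
  split=> [q Aq|q Aq|q r Aq Ar].
  - have [|_ [e xe <-]] := low (p (phi q)); first by exists (phi q).
    by have [r Ar <-] := lift e xe; rewrite -phi_mono; exists r.
  - have [|_ [e xe <-]] := up (p (phi q)); first by exists (phi q).
    by have [r Ar <-] := lift e xe; rewrite -phi_mono; exists r.
  - rewrite phi_mono => qr.
    have [||_ [e xe <-]] := mid (p (phi q)) (p (phi r)) _ _ qr.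
    + by exists (phi q).
    + by exists (phi r).
    by have [t At <-] := lift e xe; rewrite -!phi_mono; exists t.
have Acmp x y : (x < y) <-> (cylinder n (A x) `<` cylinder n (A y)).
  split=> [xy|[/(cylinder_sub n_ge1) xy nyx]].
    by split; rewrite (cylinder_sub n_ge1); [exact/Ale/ltW | exact: Alt].
  rewrite ltNge; apply/negP => /Ale yx; apply: nyx; exact/cylinder_sub.
exists (range (fun x => cylinder n (A x))); split; last first.
  exists (fun x => cylinder n (A x)); split=> //; split=> [x _|x y _ _ xy|//].
    by exists x.
  by case: (ltgtP x y) => // /Acmp; rewrite xy => -[].
split.
  split=> [_ [x _ <-]|_ _ [x _ <-] [y _ <-]]; first exact: dense_endless_copy.
  have [xy|/ltW yx] := leP x y; [left | right];
    by rewrite (cylinder_sub n_ge1); apply: Ale.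
move=> D [Dcopies Dtotal] CD; apply/seteqP; split=> // X DX.
have [S deS XS] := copy_dense_endless n_ge1 (Dcopies X DX).
have SA y : A y `<=` S \/ S `<=` A y.
  have := Dtotal _ _ (CD (cylinder n (A y)) (ex_intro2 _ _ y I erefl)) DX.
  by rewrite XS !(cylinder_sub n_ge1).
(* Maximality: [S] is compared with the stage at the supremum [x] of all [y] whose stage lies in
   [S], and turns out to equal it. *)
pose B y := A y `<=` S.
have Bbot : B bot.
  move=> q [[[w [wq _]]]|[_]]; last by rewrite ltNge botP.
  by move=> /(lt_le_trans wq); rewrite ltNge botP.
have [x [xub xsup]] := complete_sup L_complete (ex_intro _ bot Bbot : B !=set0).
have SAx y : x < y -> S `<=` A y.
  by move=> xy; case: (SA y) => // /xub; rewrite leNgt xy.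
have AxS : A x `<=` S.
  have [//|nBx] := pselect (B x).
  move=> q [[Jq qx]|[Kq qx]]; last first.
    by have [b Bb qb] := xsup _ qx; apply: (Bb q); right.
  (* If [phi q] were [x], then [x] would have an immediate predecessor, so the supremum would be
     attained, against [nBx]. *)
  have qltx : phi q < x.
    rewrite lt_neqAle qx andbT; apply/eqP => qx'; rewrite qx' in Jq.
    have [w [wx nw]] := Jq; have [b Bb wb] := xsup w wx.
    apply: nw; exists b; rewrite wb lt_neqAle xub // andbT.
    by apply/eqP => bx; apply: nBx; rewrite -bx.
  by have [b Bb qb] := xsup _ qltx; apply: (Bb q); left; rewrite ltW.
have Sx q : S q -> phi q <= x.
  move=> Sq.
  rewrite leNgt; apply/negP => xq.
  have [[w /andP[xw wq]]|nw] := pselect (exists w, x < w < phi q).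
    case: (SAx w xw q Sq) => -[_]; first by rewrite leNgt wq.
    by rewrite ltNge (ltW wq).
  (* [phi q] is the right end of a jump, hence [S] is the stage at [phi q]. *)
  have /xub : B (phi q).
    move=> r [[Jr rq]|[Kr rq]]; last first.
      apply: AxS; right; split=> //.
      rewrite lt_neqAle leNgt; apply/andP; split; last first.
        by apply/negP => xr; apply: nw; exists (phi r); rewrite xr.
      (* Here [x] would be interior to a jump-free interval although [phi q] is its immediate
         successor. *)
      apply/eqP => rx; have [a [b [/andP[ar rb] free]]] := K_inner Kr.
      have [qb|bq] := leP (phi q) b.
        by apply: free; exists (phi q); [exists x | rewrite (lt_trans ar rq)].
      by apply: nw; exists b; rewrite bq -rx rb.
    have [rx|xr] := leP (phi r) x; first by apply: AxS; left.
    have -> : r = q; last by [].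
    apply: phi_inj; apply/eqP; rewrite eq_le rq leNgt.
    by apply/negP => rq'; apply: nw; exists (phi r); rewrite xr.
  by rewrite leNgt xq.
exists x => //; rewrite XS; congr (cylinder n _); apply/seteqP; split=> // q Sq.
have qx := Sx q Sq; have [Jq|Kq] := phiE q; first by left.
(* The only possible surplus of [S] is a point of [K] at [x] itself; by [K_top] it would be the
   greatest element of [S], which has none. *)
right; split=> //; rewrite lt_neqAle qx andbT; apply/eqP => qx'.
have [_ up _] := deS; have [r Sr] := up q Sq.
have [->|rq] := eqVneq r q; rewrite ?ltxx // => qr.
suff : (r < q)%R by rewrite (lt_gtF qr).
rewrite phi_mono; apply: K_top => //.
have rltq : phi r < phi q by rewrite lt_neqAle (inj_eq phi_inj) rq qx' Sx.
by have [Jr|Kr] := phiE r; [left; rewrite ltW | right].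
Qed.
End Chain.

(** * Countability drawn from the real embedding *)

Section Embedding.
Context {d : Order.disp_t} {L : orderType d} {R : realType}.
Local Open Scope order_scope.
Variable f : L -> R.
Hypothesis f_mono : forall x y, (x < y) = (f x < f y).

Lemma rat_between (a b : R) : a < b -> exists q : rat, a < ratr q < b.
Proof. by move=> /rat_in_itvoo[q]; rewrite in_itv; exists q. Qed.

(** The images of distinct jumps under [f] bound disjoint real intervals; a rational chosen in each
    serves as code. *)
Lemma has_pred_code : exists c : L -> nat, {in has_pred &, injective c}.
Proof.
have /choice[r rP] x : exists q : rat, has_pred x ->
    (forall y, y < x -> f y < ratr q) /\ ratr q < f x.
  have [[w [wx nw]]|?] := pselect (has_pred x); last by exists 0%R.
  have := wx; rewrite f_mono => /rat_between[q /andP[wq qx]].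
  exists q => _; split=> // y yx; apply: le_lt_trans wq.
  rewrite leNgt -f_mono; apply/negP => wy.
  by apply: nw; exists y; rewrite wy.
have rlt x y : has_pred x -> has_pred y -> x < y -> r x < r y.
  move=> Jx Jy xy; rewrite -(ltr_rat R).
  by apply: lt_trans (proj1 (rP y Jy) x xy); have [] := rP x Jx.
exists (pickle \o r) => x y /set_mem Jx /set_mem Jy /(pcan_inj pickleK) rxy.
case: (ltgtP x y) => // xy; last by have := rlt y x Jy Jx xy; rewrite rxy ltxx.
by have := rlt x y Jx Jy xy; rewrite rxy ltxx.
Qed.

(** For each rational interval that meets the image of [W], one point of [W] mapped into it is
    chosen; [x0] is the default of [xget]. *)
Lemma countable_dense_subset (W : set L) (x0 : L) : exists K : set L,
  [/\ countable K, K `<=` W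
    & forall x w y, W w -> x < w < y -> exists2 k, K k & x < k < y].
Proof.
pose P (c : rat * rat) := [set k | W k /\ (ratr c.1 < f k < ratr c.2)%R].
pose K := [set xget x0 (P c) | c in [set c | P c !=set0]].
have KP c : P c !=set0 -> P c (xget x0 (P c)) by move=> ?; apply: xgetPex.
exists K; split.
- by apply: sub_countable (countableP _); apply: card_image_le.
- by move=> _ [c /KP[]? _ <-].
- move=> x w y Ww; rewrite !f_mono => /andP[].
  move=> /rat_between[q /andP[xq qw]] /rat_between[r /andP[wr ry]].
  have Pw : P (q, r) !=set0 by exists w; split=> //=; rewrite qw.
  have [_ /= /andP[qk kr]] := KP _ Pw.
  exists (xget x0 (P (q, r))); first by exists (q, r).
  by rewrite !f_mono (lt_trans xq qk) (lt_trans kr ry).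
Qed.

Lemma countable_support (K : set L) : countable K -> countable (support K).
Proof.
have [cJ cJinj] := has_pred_code; move=> /countable_injP[cK cKinj].
apply/countable_injP.
exists (fun e => pickle (if `[< has_pred e >] then inl (cJ e) else inr (cK e))).
move=> x y /set_mem Ex /set_mem Ey /(pcan_inj pickleK).
case: asboolP => Jx; case: asboolP => Jy // [].
  by apply: cJinj; rewrite inE.
case: Ex => // Kx; case: Ey => // Ky.
by apply: cKinj; rewrite inE.
Qed.

Section Inner.
Variable K : set L.
Hypothesis K_dense : forall x y : L, x < y -> jump_free x y ->
  exists2 k, K k & x < k < y.

(** The jump-free interval around [e] is cut off at [w] before [K_dense] is applied. *)
Lemma inner_below e w : inner e -> w < e -> exists2 k, K k & w < k < e.
Proof.
move=> [a [b [/andP[ae eb] free]]] we.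
have [||k Kk /andP[]] := K_dense (x := Order.max a w) (y := e).
- by rewrite gt_max ae.
- by apply: jump_free_sub free _ (ltW eb); rewrite le_max lexx.
- by rewrite gt_max => /andP[_ wk] ke; exists k; rewrite ?wk.
Qed.

Lemma inner_above e w : inner e -> e < w -> exists2 k, K k & e < k < w.
Proof.
move=> [a [b [/andP[ae eb] free]]] we.
have [||k Kk /andP[ek]] := K_dense (x := e) (y := Order.min b w).
- by rewrite lt_min eb.
- by apply: jump_free_sub free (ltW ae) _; rewrite ge_min lexx.
- by rewrite lt_min => /andP[_ wk]; exists k; rewrite ?ek.
Qed.

End Inner.

(** Collects what [stages_maximal_chain] demands of [K] and [p]. *)
Definition good_layout (K : set L) (p : L -> R) :=
  [/\ K `<=` inner,
      forall x y : L, x < y -> jump_free x y -> exists2 k, K k & x < k < y,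
      countable (support K) /\ {in support K &, injective p},
      forall k e, K k -> stage K k e -> p e < p k
    & forall x, dense_endless (p @` stage K x)].

(** * The two constructions of positions *)

Variables (bot top : L).
Hypothesis botP : is_least bot.

Let has_pred_gt e : has_pred e -> bot < e.
Proof. by move=> [w [we _]]; apply: le_lt_trans (botP w) we. Qed.

(* The right ends of jumps are placed at points [z i] that [K] avoids, all
   of them below every jump. *)
Lemma good_layout_free_start (a : L) : bot < a -> jump_free bot a ->
  exists K p, good_layout K p.
Proof.
move=> ba free; have [cJ cJinj] := has_pred_code.
have /choice[ch chP] y : exists w, y < a -> y < w < a.
  have [ya|?] := pselect (y < a); last by exists y.
  have [w wP] := jump_free_dense ya (jump_free_sub free (botP y) (lexx a)).
  by exists w.
pose z := fix z i := if i is i'.+1 then ch (z i') else bot.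
have za i : z i < a by elim: i => [//|i /chP/andP[]].
have zS i : z i < z i.+1 by have /andP[] := chP _ (za i).
have z_lt : {homo z : i j / (i < j)%N >-> i < j}.
  by apply: homo_ltn => //; apply: lt_trans.
have z_mono : {mono z : i j / (i <= j)%N >-> i <= j} by apply: le_mono.
(* The index starts at 1 because [z 0] is [bot], which is not an inner point. *)
pose Z := [set z i.+1 | i in [set: nat]].
have [K [cK KW Kd]] := countable_dense_subset (inner `\` Z) bot.
have Kdense x y : x < y -> jump_free x y -> exists2 k, K k & x < k < y.
  move=> xy fxy; suff [w /andP[xw wy] nZw] : exists2 w, x < w < y & ~ Z w.
    by apply: (Kd x w y); rewrite ?xw //; split=> //; exists x, y; rewrite xw.
  have [w /andP[xw wy]] := jump_free_dense xy fxy.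
  have [[i _ iw]|nZw] := pselect (Z w); last by exists w; rewrite ?xw.
  (* If [w] is some [z i.+1], a point just below it, above both [x] and [z i], avoids [Z]. *)
  have mw : Order.max x (z i) < w by rewrite gt_max xw -iw zS.
  have [||v /andP[]] := @jump_free_dense _ _ (Order.max x (z i)) w => //.
    by apply: jump_free_sub fxy _ (ltW wy); rewrite le_max lexx.
  rewrite gt_max => /andP[xv zv] vw; exists v; first by rewrite xv (lt_trans vw).
  move=> [j _ jv]; move: zv vw; rewrite -jv -iw !ltNge !z_mono -!ltnNge.
  by rewrite ltnS => ij; rewrite ltnS ltnNge ij.
pose u e := if `[< K e >] then e else z (cJ e).+1.
have uK e : K e -> u e = e by move=> Ke; rewrite /u; case: asboolP.
have KJ e : K e -> ~ has_pred e by move=> /KW[/inner_not_has_pred].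
have uJ e : has_pred e -> u e = z (cJ e).+1.
  by move=> Je; rewrite /u; case: asboolP => // /KJ.
have Ja e : has_pred e -> a < e.
  move=> Je; rewrite ltNge; apply/negP => ea; apply: free; exists e => //.
  by rewrite has_pred_gt.
(* Every position used at stage [x] is an inner point below [x]. Density and endlessness of the
   stage thus reduce to those of [K] near inner points. *)
have u_inner x e : stage K x e -> inner (u e) /\ u e < x.
  case=> [[Je ex]|[Ke ex]]; last by rewrite uK //; have [] := KW e Ke.
  rewrite uJ //; split; last exact: lt_trans (za _) (lt_le_trans (Ja e Je) ex).
  exists bot, a; rewrite za andbT; split=> //.
  exact: le_lt_trans (botP _) (zS _).
have f_inj : injective f.
  move=> x y fxy; have := f_mono x y; have := f_mono y x.
  by rewrite fxy ltxx; case: ltgtP.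
exists K, (f \o u); split=> //.
- by move=> k /KW[].
- split; first exact: countable_support.
  have aux x y : has_pred x -> K y -> u x <> u y.
    move=> Jx Ky; rewrite uJ // uK // => xy; have [_] := KW y Ky; apply.
    by rewrite -xy; exists (cJ x).
  move=> x y /set_mem Ex /set_mem Ey /f_inj; case: Ex Ey => [Jx|Kx] [Jy|Ky].
  + rewrite !uJ // => zxy; apply: cJinj; rewrite ?inE //.
    by apply/eqP; rewrite eqn_leq -![(cJ _ <= _)%N]ltnS -!z_mono zxy lexx.
  + by move=> /aux-/(_ Jx Ky).
  + by move=> /esym/aux-/(_ Jy Kx).
  + by rewrite !uK.
- by move=> k e Kk ke; rewrite /= -f_mono (uK k) //; have [] := u_inner k e ke.
move=> x; have Kstage k e : K k -> stage K x e -> k <= u e -> stage K x k.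
  by move=> Kk /u_inner[_ ex] ke; right; split=> //; apply: le_lt_trans ex.
split=> [_ [e xe <-]|_ [e xe <-]|_ _ [e xe <-] [e' xe' <-]] /=.
- have [ue ex] := u_inner x e xe.
  have be : bot < u e by have [b [c [/andP[/(le_lt_trans (botP b))]]]] := ue.
  have [k Kk /andP[_ ke]] := inner_below Kdense ue be.
  exists (f k); last by rewrite -f_mono.
  by exists k; rewrite /= ?uK //; apply: Kstage (ltW ke).
- have [ue ex] := u_inner x e xe.
  have [k Kk /andP[ek kx]] := inner_above Kdense ue ex.
  exists (f k); last by rewrite -f_mono.
  by exists k; rewrite /= ?uK //; right.
- rewrite -f_mono => ee'; have [ue' ex'] := u_inner x e' xe'.
  have [k Kk /andP[ek ke]] := inner_below Kdense ue' ee'.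
  exists (f k); last by rewrite -!f_mono ek.
  by exists k; rewrite /= ?uK //; apply: Kstage (ltW ke).
Qed.

(** Only finitely many rationals have codes below [N]; the interval is cut at each one that it
    contains. A large code will mean a jump close to [bot]. *)
Lemma avoid_codes (N : nat) (a b : R) : a < b -> exists a' b',
  [/\ a <= a', a' < b', b' <= b &
    forall q : rat, a' < ratr q < b' -> (N <= pickle q)%N].
Proof.
move=> ab; elim: N => [|N [a' [b' [aa' ab' bb' avoid]]]].
  by exists a, b; split.
have [[q /andP[aq qb] qN]|nq] :=
    pselect (exists2 q : rat, a' < ratr q < b' & pickle q = N).
  exists a', (ratr q); split=> //; first exact: le_trans (ltW qb) bb'.
  move=> r /andP[ar rq]; rewrite ltn_neqAle avoid ?andbT ?ar ?(lt_trans rq) //.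
  apply/eqP; rewrite -qN => /(pcan_inj pickleK) qr.
  by rewrite qr ltxx in rq.
exists a', b'; split=> // q aqb; rewrite ltn_neqAle avoid // andbT.
by apply/eqP => Nq; apply: nq; exists q.
Qed.

(** Integers are kept away because they will be positions of the leftover jumps. *)
Lemma avoid_int (a b : R) : a < b -> exists a' b',
  [/\ a <= a', a' < b', b' <= b &
    forall m : int, ~ (a' < m%:~R < b')%R].
Proof.
move=> ab; have [[m /andP[am mb]]|nm] :=
    pselect (exists m : int, (a < m%:~R < b)%R); last first.
  by exists a, b; split=> // m mab; apply: nm; exists m.
exists (m%:~R)%R, (Order.min b (m + 1)%:~R)%R; split.
- exact: ltW.
- by rewrite lt_min mb ltr_int ltzD1 lexx.
- by rewrite ge_min lexx.
- by move=> m'; rewrite lt_min !ltr_int ltzD1 => /and3P[mm _]; rewrite leNgt mm.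
Qed.

(* The jumps [xs i] decrease to [bot] and take the negative non-integral
   rationals as positions, so that every tail of them is dense; the other jumps
   go to the negative integers, and [K] keeps its own order above all jumps. *)
Lemma good_layout_jumps_start : bot < top ->
  (forall x, bot < x -> exists2 j, has_pred j & j < x) ->
  exists K p, good_layout K p.
Proof.
move=> bt Jbot; have [cJ cJinj] := has_pred_code.
have /choice[ch chP] y : exists j, bot < y -> has_pred j /\ j < y.
  have [/Jbot[j]|?] := pselect (bot < y); first by exists j.
  by exists y.
(* The jump with code [i], or [top] if there is none. Taking [xs i.+1] below [e i] makes the
   sequence coinitial above [bot]. *)
pose e i := xget top [set j | has_pred j /\ cJ j = i].
have e_gt i : bot < e i by rewrite /e; case: xgetP => // j _ [/has_pred_gt].
pose xs := fix xs i :=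
  if i is i'.+1 then ch (Order.min (xs i') (e i')) else ch top.
have xsJ i : has_pred (xs i).
  elim: i => [|i /has_pred_gt xi]; apply: (proj1 (chP _ _)) => //.
  by rewrite lt_min xi e_gt.
have xsS i : xs i.+1 < Order.min (xs i) (e i).
  by apply: (proj2 (chP _ _)); rewrite lt_min e_gt has_pred_gt.
have xs_lt i j : (i < j)%N -> xs j < xs i.
  elim: j => // j IHj; have := xsS j; rewrite lt_min => /andP[xj _].
  rewrite ltnS leq_eqVlt => /predU1P[->//|/IHj]; exact: lt_trans.
have xs_inj : injective xs.
  by move=> i j xij; case: (ltngtP i j) => // /xs_lt; rewrite xij ltxx.
have xs_small x : bot < x -> exists N, forall i, (N <= i)%N -> xs i < x.
  move=> /Jbot[j Jj jx]; exists (cJ j).+1 => i Ni.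
  have xN : xs (cJ j).+1 < x.
    have := xsS (cJ j); rewrite lt_min => /andP[_]; rewrite {1}/e; case: xgetP.
      move=> j' _ [Jj' cj] xj; apply: lt_trans jx.
      by move: xj; rewrite (cJinj j' j) ?inE.
    by move=> /(_ j) [].
  move: Ni; rewrite leq_eqVlt => /predU1P[<-//|/xs_lt/lt_trans]; exact.
pose D := [set q : rat | (q < 0)%R /\ forall m : int, q <> (m%:~R)%R].
(* The jump [xs i] goes to the rational in [D] with code [i]; if there is none, it is treated like
   the jumps outside the sequence and goes to a negative integer given by its code. *)
have /choice[v vP] j : exists t : rat, D t /\ j = xs (pickle t) \/
    (forall q, D q -> j <> xs (pickle q)) /\ t = (- (cJ j).+1%:R)%R.
  have [[q Dq jq]|nq] := pselect (exists2 q, D q & j = xs (pickle q)).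
    by exists q; left.
  exists (- (cJ j).+1%:R)%R; right; split=> // q Dq jq.
  by apply: nq; exists q.
have v_lt0 j : (v j < 0)%R.
  by case: (vP j) => [[[]]//|[_ ->]]; rewrite oppr_lt0 ltr0n.
have v_inj : {in has_pred &, injective v}.
  have aux j : (- (cJ j).+1%:R)%R = ((- (cJ j).+1%:Z)%:~R)%R :> rat.
    by rewrite rmorphN.
  move=> j j' /set_mem Jj /set_mem Jj' vjj.
  case: (vP j) (vP j') => [[[_ Dj] jv]|[_ vj]] [[[_ Dj'] jv']|[_ vj']].
  - by rewrite jv jv' vjj.
  - by case: (Dj (- (cJ j').+1%:Z)%R); rewrite vjj vj' aux.
  - by case: (Dj' (- (cJ j).+1%:Z)%R); rewrite -vjj vj aux.
  - apply: cJinj; rewrite ?inE //; move/eqP: vjj.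
    by rewrite vj vj' eqr_opp eqr_nat eqSS => /eqP.
have [K [cK KW Kd]] := countable_dense_subset inner bot.
have Kdense x y : x < y -> jump_free x y -> exists2 k, K k & x < k < y.
  move=> xy fxy; have [w xwy] := jump_free_dense xy fxy.
  by apply: (Kd x w y) => //; exists x, y.
(* Subtracting [f bot] makes the positions of [K] positive, while those of the jumps are
   negative. *)
pose p x : R := if `[< K x >] then (f x - f bot)%R else ratr (v x).
have pK x : K x -> p x = (f x - f bot)%R by move=> Kx; rewrite /p; case: asboolP.
have pJ x : has_pred x -> p x = ratr (v x).
  by move=> Jx; rewrite /p; case: asboolP => // /KW/inner_not_has_pred.
have pJ0 x : has_pred x -> (p x < 0)%R.
  by move=> Jx; rewrite pJ // ltrq0.
have pK0 x : K x -> (0 < p x)%R.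
  move=> Kx; rewrite pK // subr_gt0 -f_mono.
  by have [a [b [/andP[/(le_lt_trans (botP a))]]]] := KW x Kx.
have pKlt x y : K x -> K y -> (p x < p y)%R = (x < y).
  by move=> Kx Ky; rewrite !pK // ltrD2r f_mono.
(* However close [x] is to [bot], the jumps up to [x] are dense in the negative reals: a
   non-integral rational of code at least [N] belongs to some [xs i] below [x]. *)
have p_dense x (a b : R) : bot < x -> (a < b)%R -> (b <= 0)%R ->
    exists2 j, has_pred j /\ j <= x & (a < p j < b)%R.
  move=> /xs_small[N NP] ab b0.
  have [a1 [b1 [aa1 ab1 bb1 noint]]] := avoid_int ab.
  have [a2 [b2 [aa2 ab2 bb2 nocode]]] := avoid_codes N ab1.
  have [q /andP[aq qb]] := rat_between ab2.
  have Dq : D q.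
    split.
      rewrite -(ltrq0 R) (lt_le_trans qb) // (le_trans bb2) //.
      exact: le_trans bb1 b0.
    move=> m qm; apply: (noint m).
    by rewrite -(ratr_int R m) -qm (le_lt_trans aa2 aq) (lt_le_trans qb bb2).
  exists (xs (pickle q)).
    by split=> //; apply/ltW/NP/nocode; rewrite aq.
  rewrite pJ //; have -> : v (xs (pickle q)) = q.
    case: (vP (xs (pickle q))) => [[_ /xs_inj]|[/(_ q Dq)]//].
    by move/(pcan_inj pickleK).
  rewrite (le_lt_trans aa1) ?(lt_le_trans qb) ?(le_trans bb2) //.
  exact: le_lt_trans aa2 aq.
exists K, p; split=> //.
- split; first exact: countable_support.
  move=> x y /set_mem Ex /set_mem Ey.
  case: Ex Ey => [Jx|Kx] [Jy|Ky] pxy.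
  + by move: pxy; rewrite !pJ // => /(fmorph_inj (@ratr R))/v_inj-> //; rewrite inE.
  + by have := pJ0 x Jx; rewrite pxy (lt_gtF (pK0 y Ky)).
  + by have := pJ0 y Jy; rewrite -pxy (lt_gtF (pK0 x Kx)).
  + have := pKlt x y Kx Ky; have := pKlt y x Ky Kx.
    by rewrite pxy ltxx; case: ltgtP.
- move=> k x Kk [[Jx _]|[Kx xk]]; last by rewrite pKlt.
  exact: lt_trans (pJ0 x Jx) (pK0 k Kk).
move=> x.
have x_gt w : stage K x w -> bot < x.
  case=> -[]; last by move=> _; apply: le_lt_trans.
  by move=> /has_pred_gt/lt_le_trans; apply.
split=> [_ [w xw <-]|_ [w xw <-]|_ _ [w xw <-] [w' xw' <-]] /=.
- have [||j xj /andP[_ jb]] := p_dense x (Order.min 0 (p w) - 1)%R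
    (Order.min 0 (p w))%R (x_gt w xw).
  + by rewrite ltrBlDr ltrDl.
  + by rewrite ge_min lexx.
  exists (p j); first by exists j => //; left.
  by move: jb; rewrite lt_min => /andP[].
- have bx := x_gt w xw; case: xw => [[Jw wx]|[Kw wx]].
    have [j xj /andP[wj _]] := p_dense x (p w) 0%R bx (pJ0 w Jw) (lexx _).
    by exists (p j) => //; exists j => //; left.
  have [k Kk /andP[wk kx]] := inner_above Kdense (KW w Kw) wx.
  by exists (p k); rewrite ?pKlt //; exists k => //; right.
- move=> ww'; have bx := x_gt w xw; case: (xw) => [[Jw wx]|[Kw wx]].
    have [||j xj /andP[wj]] := p_dense x (p w) (Order.min 0 (p w'))%R bx.
    + by rewrite lt_min ww' pJ0.
    + by rewrite ge_min lexx.
    rewrite lt_min => /andP[_ jw]; exists (p j); last by rewrite wj.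
    by exists j => //; left.
  case: xw' => [[Jw' _]|[Kw' wx']].
    by have := lt_trans ww' (pJ0 w' Jw'); rewrite (lt_gtF (pK0 w Kw)).
  move: ww'; rewrite pKlt // => ww'.
  have [k Kk /andP[wk kw]] := inner_below Kdense (KW w' Kw') ww'.
  exists (p k); last by rewrite !pKlt // wk.
  by exists k => //; right; split=> //; apply: lt_trans wx'.
Qed.

End Embedding.

(* L_nontrivial: for the one-point order the conclusion fails (every maximal
   chain contains both the empty set and the whole of C_n), although its unique
   element vacuously has no immediate successor. *)
Theorem theorem6p1 (R : realType) (n : nat) (n_ge1 : (1 <= n)%N)
    (d : Order.disp_t) (L : orderType d)
    (L_nontrivial : exists x y : L, (x < y)%O)
    (L_embeddable : order_embeddable L R)
    (L_complete : complete_order L)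
    (L_least : forall z : L, is_least z -> non_isolated z) :
  exists C : set (set (rat * 'I_n)),
    is_maximal_chain (copies (@Cn_lt n) `|` [set set0]) C /\
    iso_onto (fun x y : L => (x < y)%O) (fun A B : set (rat * 'I_n) => A `<` B) C.
Proof.
have [f fP] := L_embeddable.
have f_mono x y : (x < y)%O = (f x < f y)%R by apply/idP/idP; case: (fP x y).
have [[bot botP] [top topP] _] := L_complete.
have bt : (bot < top)%O.
  by have [x [y /(le_lt_trans (botP x))/lt_le_trans]] := L_nontrivial; apply.
have [K [p [Kin Kd [cE pinj] Ktop de]]] : exists K p, @good_layout d L R K p.
  have [Jbot|nJ] := pselect (forall x, (bot < x)%O ->
    exists2 j, has_pred j & (j <= x)%O).
    apply: (good_layout_jumps_start f_mono botP bt) => x bx.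
    (* Non-isolation of [bot] leaves room for [y], so that the jump obtained lies strictly below
       [x]. *)
    have [y /andP[by_ yx]] : exists y, (bot < y < x)%O.
      by apply: contrapT => ny; apply: (L_least bot botP); exists x.
    have [j Jj jy] := Jbot y by_; exists j => //; exact: le_lt_trans yx.
  (* Otherwise some initial interval up to [a] contains no right end of a jump, and the other layout
     applies. *)
  apply: contrapT => nK; apply: nJ => a ba; apply: contrapT => nj; apply: nK.
  apply: (good_layout_free_start f_mono botP ba) => -[j Jj /andP[_ ja]].
  by apply: nj; exists j.
exact: (stages_maximal_chain n_ge1 L_nontrivial L_complete Kin Kd cE pinj Ktop de).
Qed.
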